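(* Let $B=(V,E,\le)$ be an ordered (not necessarily simple) Bratteli diagram of finite rank, where $\le$ is a consecutive ordering. Let $T:X_B\to X_B$ be the Vershik map defined by the order $\le$ on $B$ ($T$ is not necessarily continuous everywhere) and let $\mu$ be a finite (non-zero) $T$-invariant measure, normalized to a probability measure. Assume that if two vertices in consecutive levels $V_n$, $V_{n+1}$ ($n\ge1$) are connected by an edge, then there are at least two such edges. Then the dynamical system $(X_B,\mu,T)$ is not strongly mixing.
   Context: A Bratteli diagram $B=(V,E)$ is an infinite graph with vertex set $V=\bigsqcup_{i\ge 0}V_i$ and edge set $E=\bigsqcup_{i\ge 1}E_i$, all $V_i,E_i$ finite, $V_0=\{v_0\}$, with range and source maps $r(E_i)=V_i$, $s(E_i)=V_{i-1}$, $s^{-1}(v)\ne\emptyset$ for all $v$ and $r^{-1}(v)\ne\emptyset$ for $v\ne v_0$. $X_B$ is the space of infinite paths $x=(x_i)_{i\ge1}$ from $v_0$, topologized by cylinder sets. Finite rank: $\sup_n|V_n|<\infty$. Standing assumptions on finite rank diagrams: the same number $d$ of vertices at each level $n\ge1$; a single edge from $v_0$ to each vertex of $V_1$; $X_B$ has no isolated points; the tail equivalence relation (paths agreeing from some level on) has no finite classes. Measures are Borel and non-atomic. $B$ is ordered if each set $r^{-1}(v)$, $v\in V\setminus V_0$, is linearly ordered. The ordering is consecutive if whenever edges $e,f,g$ have the same range, $e\le f\le g$, and $e$ and $g$ have the same source, then $f$ has the same source as $e$ and $g$. A (finite or infinite) path is maximal (minimal) if each of its edges $e_i$ is maximal (minimal)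 in $r^{-1}(r(e_i))$. Let $X_B^*$ be the set of infinite paths cofinal neither to a maximal nor to a minimal infinite path; for finite rank diagrams $X_B\setminus X_B^*$ is at most countable. The Vershik map $T:X_B^*\to X_B^*$ is $T(x_1,x_2,\dots)=(x_1^0,\dots,x_{k-1}^0,\overline{x_k},x_{k+1},\dots)$, where $k=\min\{n: x_n \text{ is not maximal}\}$, $\overline{x_k}$ is the successor of $x_k$ in $r^{-1}(r(x_k))$ and $(x_1^0,\dots,x_{k-1}^0)$ is the minimal path from $v_0$ to $s(\overline{x_k})$; it is defined $\mu$-almost everywhere for non-atomic $\mu$. Strongly mixing (for a probability measure $\mu$): $\mu(A\cap T^{-n}C)\to\mu(A)\mu(C)$ as $n\to\infty$ for all measurable $A,C$. *)

(* Defs.v *)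
From HB Require Import structures.
From mathcomp Require Import all_boot all_order all_algebra.
From mathcomp Require Import all_classical all_reals all_analysis.

Set Implicit Arguments.
Unset Strict Implicit.
Unset Printing Implicit Defensive.

Import Order.TTheory GRing.Theory Num.Theory.

Local Open Scope classical_set_scope.

(* [edge B n] is the set of edges from level n to level n.+1; the literature
   usually writes it E_{n+1}. *)
Record bratteli := Bratteli {
  vertex : nat -> finType;
  edge : nat -> finType;
  esource : forall n, edge n -> vertex n;
  erange : forall n, edge n -> vertex n.+1;
  root_vertex : vertex 0;
  root_vertexP : forall v : vertex 0, v = root_vertex;
  source_surj : forall n (v : vertex n), exists e : edge n, esource e = v;
  range_surj : forall n (v : vertex n.+1), exists e : edge n, erange e = v }.

Arguments esource {b n}.
Arguments erange {b n}.

Record path_space (B : bratteli) := Path {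
  path_edge :> forall n, edge B n;
  path_edgeP : forall n, esource (path_edge n.+1) = erange (path_edge n) }.

HB.instance Definition _ (B : bratteli) := gen_eqMixin (path_space B).
HB.instance Definition _ (B : bratteli) := gen_choiceMixin (path_space B).

Section path_space_topology.
Variable B : bratteli.

Let out_edge n (v : vertex B n) : edge B n := sval (cid (source_surj v)).

Let source_out_edge n (v : vertex B n) : esource (out_edge v) = v.
Proof. exact: svalP (cid (source_surj v)). Qed.

Fixpoint default_edge n : edge B n :=
  if n is m.+1 then out_edge (erange (default_edge m))
  else out_edge (root_vertex B).

Lemma default_edgeP n :
  esource (default_edge n.+1) = erange (default_edge n).
Proof. exact: source_out_edge. Qed.

HB.instance Definition _ := isPointed.Build (path_space B) (Path default_edgeP).

(* The cylinder of the finite path formed by the first n edges of x; every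
   finite path from the root extends to an infinite one, so these are all the
   cylinder sets. *)
Definition cylinder (p : nat * path_space B) : set (path_space B) :=
  [set y | forall i, (i < p.1)%N -> y i = p.2 i].

Lemma cylinder_cover : \bigcup_(p in setT) cylinder p = setT.
Proof. by apply/seteqP; split=> // x _; exists (0, x). Qed.

Lemma cylinder_join p q t : setT p -> setT q -> cylinder p t -> cylinder q t ->
  exists u, [/\ setT u, cylinder u t & cylinder u `<=` cylinder p `&` cylinder q].
Proof.
move=> _ _ pt qt; exists (maxn p.1 q.1, t); split=> // y /= yt.
split=> i ilt.
- by rewrite yt ?pt// leq_max ilt.
- by rewrite yt ?qt// leq_max ilt orbT.
Qed.

HB.instance Definition _ :=
  isBaseTopological.Build (path_space B) cylinder_cover cylinder_join.

End path_space_topology.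

Notation borel_path_space B := (g_sigma_algebraType (@open (path_space B))).

Section diagrams.
Variable B : bratteli.

Definition finite_rank := exists d : nat, forall n, (#|vertex B n| <= d)%N.

Definition cofinal (x y : path_space B) :=
  exists N, forall n, (N <= n)%N -> x n = y n.

Definition standing_assumptions :=
  [/\ exists d : nat, forall n, (0 < n)%N -> #|vertex B n| = d,
      forall v : vertex B 1, exists! e : edge B 0, erange e = v,
      forall x : path_space B, ~ isolated setT x &
      forall x : path_space B, infinite_set [set y | cofinal x y]].

Definition multiple_edges := forall n (v : vertex B n) (w : vertex B n.+1),
  (0 < n)%N -> (exists e : edge B n, esource e = v /\ erange e = w) ->
  (2 <= #|[set e : edge B n | (esource e == v) && (erange e == w)]%SET|)%N.

End diagrams.

(* A linear order on each fibre erange^-1(v); [edge_le] carries no information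
   on pairs of edges with different ranges. *)
Record edge_order (B : bratteli) := EdgeOrder {
  edge_le : forall n, rel (edge B n);
  edge_le_refl : forall n (e : edge B n), edge_le e e;
  edge_le_anti : forall n (e f : edge B n), erange e = erange f ->
    edge_le e f -> edge_le f e -> e = f;
  edge_le_trans : forall n (e f g : edge B n),
    erange e = erange f -> erange f = erange g ->
    edge_le e f -> edge_le f g -> edge_le e g;
  edge_le_total : forall n (e f : edge B n), erange e = erange f ->
    edge_le e f \/ edge_le f e }.

Arguments edge_le {B} _ {n}.

Section ordered_diagrams.
Variables (B : bratteli) (ord : edge_order B).

Definition consecutive := forall n (e f g : edge B n),
  erange e = erange f -> erange f = erange g ->
  edge_le ord e f -> edge_le ord f g -> esource e = esource g ->
  esource f = esource e.

Definition maximal_edge n (e : edge B n) :=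
  forall f : edge B n, erange f = erange e -> edge_le ord f e.

Definition minimal_edge n (e : edge B n) :=
  forall f : edge B n, erange f = erange e -> edge_le ord e f.

Definition successor_edge n (e f : edge B n) :=
  [/\ erange f = erange e, f <> e, edge_le ord e f &
      forall g : edge B n, erange g = erange e -> g <> e ->
        edge_le ord e g -> edge_le ord f g].

Definition maximal_path (x : path_space B) := forall n, maximal_edge (x n).

Definition minimal_path (x : path_space B) := forall n, minimal_edge (x n).

Definition regular_paths : set (path_space B) :=
  [set x | ~ (exists y, maximal_path y /\ cofinal x y) /\
           ~ (exists y, minimal_path y /\ cofinal x y)].

(* y is the successor path of x: the initial segment of y below level k is
   forced to be the minimal path to esource (y k). *)
Definition vershik_step (x y : path_space B) := exists k : nat,
  [/\ forall i, (i < k)%N -> maximal_edge (x i),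
      ~ maximal_edge (x k),
      successor_edge (x k) (y k),
      forall i, (i < k)%N -> minimal_edge (y i) &
      forall i, (k < i)%N -> y i = x i].

(* The Vershik map is determined on [regular_paths] only; the complement is
   countable, hence null for every non-atomic measure, and T is arbitrary
   there. *)
Definition vershik_map (T : path_space B -> path_space B) :=
  forall x, regular_paths x -> vershik_step x (T x).

End ordered_diagrams.

Section measures.
Context d (X : measurableType d) (R : realType).
Local Open Scope ring_scope.
Variable mu : {measure set X -> \bar R}.
Local Open Scope ereal_scope.

Definition non_atomic := ~ exists A : set X,
  [/\ measurable A, 0 < mu A &
      forall C, measurable C -> C `<=` A -> mu C = 0 \/ mu C = mu A].

Definition invariant_measure (T : X -> X) :=
  forall A, measurable A -> mu (T @^-1` A) = mu A.

Definition strongly_mixing (T : X -> X) :=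
  forall A C, measurable A -> measurable C ->
    mu (A `&` iter n T @^-1` C) @[n --> \oo] --> mu A * mu C.

End measures.

(* Main.v *)
Require Import Defs.
From mathcomp Require Import all_boot all_order all_algebra.
From mathcomp Require Import all_classical all_reals all_analysis.
From mathcomp Require Import zify.

(* Let h(v) be the number of finite paths from the root to a vertex v of level
   n, i.e. the height of the tower over v, and let A be a cylinder determined by
   the first n edges. As the order is consecutive, a point of A passing through
   v whose next edge is not the last one among its parallel edges comes back to
   A after exactly h(v) steps. Since every edge has a parallel one, T^-h(v) maps
   the points of A whose next edge is the last one into these; hence the latter
   make up at least half of A inside the tower, and
   mu(A meet tower v) <= 2 mu(A meet T^-h(v) A). Summing over the at most d
   vertices of level n, where h(v) >= n, mixing would give
   mu(A) <= 2 d mu(A)^2, which fails for cylinders of small positive measure. *)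

Set Implicit Arguments.
Unset Strict Implicit.
Unset Printing Implicit Defensive.

Import Order.TTheory GRing.Theory Num.Theory.

Local Open Scope classical_set_scope.

(** * Towers over the vertices of a level, and return times *)

Section towers.
Variables (B : bratteli) (ord : edge_order B).

Fixpoint tower_height n : vertex B n -> nat :=
  if n is m.+1 then
    fun w => \sum_(e : edge B m | erange e == w) tower_height (esource e)
  else fun=> 1.

Definition edge_lt n : rel (edge B n) :=
  fun e f => [&& erange e == erange f, edge_le ord e f & e != f].

(** Counts the finite paths from the root into [erange e] whose last edge precedes [e]. *)
Definition height_below n (e : edge B n) :=
  \sum_(g | edge_lt g e) tower_height (esource g).

(* The number of finite paths into the n-th vertex of x that precede the
   initial segment of x, i.e. the floor occupied by x in its level-n tower. *)
Fixpoint tower_pos n (x : path_space B) : nat :=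
  if n is m.+1 then tower_pos m x + height_below (x m) else 0.

Lemma edge_ltP n (e f : edge B n) :
  reflect [/\ erange e = erange f, edge_le ord e f & e <> f] (edge_lt e f).
Proof. by apply: (iffP and3P) => -[]; split=> //; apply/eqP. Qed.

Lemma edge_lt_total n (e f : edge B n) :
  erange e = erange f -> e <> f -> edge_lt e f || edge_lt f e.
Proof.
move=> ef nef; apply/orP; have [le|le] := edge_le_total ord ef.
  by left; apply/edge_ltP.
by right; apply/edge_ltP; split=> // /esym.
Qed.

Lemma edge_lt_trans n (e f g : edge B n) :
  edge_lt e f -> edge_lt f g -> edge_lt e g.
Proof.
move=> /edge_ltP[ef lef nef] /edge_ltP[fg lfg nfg]; apply/edge_ltP.
split; [by rewrite ef | exact: edge_le_trans lef lfg | move=> eg].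
by apply: nef; apply: edge_le_anti lef _; rewrite ?eg.
Qed.

Lemma edge_lt_irr n (e : edge B n) : edge_lt e e = false.
Proof. by rewrite /edge_lt !eqxx andbF. Qed.

Lemma edge_lt_minimal n (e f : edge B n) : edge_lt e f -> ~ minimal_edge ord f.
Proof.
move=> /edge_ltP[ef le nef] /(_ _ ef) le'.
by apply: nef; exact: edge_le_anti ef le le'.
Qed.

Lemma edge_lt_maximal n (e f : edge B n) : edge_lt e f -> ~ maximal_edge ord e.
Proof.
move=> /edge_ltP[ef le nef] /(_ _ (esym ef)) le'.
by apply: nef; exact: edge_le_anti ef le le'.
Qed.

Lemma successor_lt n (e f : edge B n) : successor_edge ord e f -> edge_lt e f.
Proof. by case=> fe nfe le _; apply/edge_ltP; split=> // /esym. Qed.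

Lemma successor_ltE n (e f g : edge B n) : successor_edge ord e f ->
  edge_lt g f = (g == e) || edge_lt g e.
Proof.
move=> ef; have lef := successor_lt ef; have [fe nfe le H] := ef.
have [->//|/eqP ge] /= := eqVneq g e.
apply/idP/idP => [lgf|lge]; last exact: edge_lt_trans lge lef.
have [gf gle ngf] := edge_ltP _ _ lgf.
have /orP[//|/edge_ltP[_ eg _]] := edge_lt_total (etrans gf fe) ge.
by case: ngf; apply: edge_le_anti gle _ => //; apply: H => //; rewrite gf.
Qed.

Lemma maximal_ltE n (e g : edge B n) : maximal_edge ord e ->
  (erange g == erange e) = (g == e) || edge_lt g e.
Proof.
move=> me; have [->|/eqP ge] := eqVneq g e; first by rewrite eqxx.
apply/eqP/idP => [|/edge_ltP[]//] gre.
by apply/edge_ltP; split=> //; exact: me.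
Qed.

(** Here [P] is the initial segment ending at [e]: the edges before a successor of [e], or all edges
    with the range of [e] when [e] is maximal. *)
Lemma height_split n (P : pred (edge B n)) (e : edge B n) :
  P =1 (fun g => (g == e) || edge_lt g e) ->
  \sum_(g | P g) tower_height (esource g) =
  height_below e + tower_height (esource e).
Proof.
move=> PE; rewrite (bigD1 e) ?PE ?eqxx//= addnC; congr addn.
apply: eq_bigl => g; rewrite PE.
by have [->|] := eqVneq g e; rewrite ?edge_lt_irr ?andbT.
Qed.

Lemma height_below_successor n (e f : edge B n) : successor_edge ord e f ->
  height_below f = height_below e + tower_height (esource e).
Proof. by move=> ef; apply: height_split => g; exact: successor_ltE. Qed.

Lemma height_maximal n (e : edge B n) : maximal_edge ord e ->
  tower_height (erange e) = height_below e + tower_height (esource e).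
Proof. by move=> me; apply: height_split => g; exact: maximal_ltE. Qed.

Lemma height_below_minimal n (e : edge B n) :
  minimal_edge ord e -> height_below e = 0.
Proof.
move=> me; apply: big1 => g /edge_lt_minimal; contradiction.
Qed.

Lemma leq_height_split n (P : pred (edge B n)) (e : edge B n) :
  (forall g, (g == e) || edge_lt g e -> P g) ->
  height_below e + tower_height (esource e) <=
  \sum_(g | P g) tower_height (esource g).
Proof.
move=> PE; rewrite -(height_split (e := e) (frefl _)) big_mkcond [leqRHS]big_mkcond.
by apply: leq_sum => g _; case: ifP => // /PE ->.
Qed.

Lemma leq_height_below n (e f : edge B n) : edge_lt e f ->
  height_below e + tower_height (esource e) <= height_below f.
Proof.
move=> ef; apply: leq_height_split => g /predU1P[->//|ge].
exact: edge_lt_trans ge ef.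
Qed.

Lemma leq_height_range n (e : edge B n) :
  height_below e + tower_height (esource e) <= tower_height (erange e).
Proof. by apply: leq_height_split => g /predU1P[->//|/andP[]]. Qed.

Lemma tower_height_gt0 n (v : vertex B n) : 0 < tower_height v.
Proof.
elim: n v => [//|n IH] v; have [e <-] := range_surj v.
by apply: leq_trans (leq_height_range e); rewrite addn_gt0 IH orbT.
Qed.

(** Above level 1 every vertex receives two parallel edges, so its height is at least twice that of
    some vertex one level down; heights therefore grow strictly. *)
Lemma tower_height_ge n (v : vertex B n) : multiple_edges B ->
  n <= tower_height v.
Proof.
(* Level 1 is treated apart, since [multiple_edges] concerns only edges that start at level 1 or
   higher. *)
move=> mult; elim: n v => [//|[_ v|n IH v]]; first exact: tower_height_gt0.
have [e ev] := range_surj v.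
have := mult _ (esource e) v (ltn0Sn _) (ex_intro _ e (conj erefl ev)).
move=> /card_gt1P[f [g []]]; rewrite !inE => /andP[/eqP fs /eqP fr].
move=> /andP[/eqP gs /eqP gr] /eqP fg.
wlog lt : f g fs fr gs gr fg / edge_lt f g.
  move=> H; have /orP[] := edge_lt_total (etrans fr (esym gr)) fg.
    exact: H.
  by apply: H => // /esym.
have := leq_height_range g; rewrite gr; apply: leq_trans.
apply: leq_ltn_trans (IH (esource f)) _.
by have := leq_height_below lt; have := tower_height_gt0 (esource g); lia.
Qed.

Lemma tower_pos_lt n (x : path_space B) : tower_pos n x < tower_height (esource (x n)).
Proof.
elim: n => [|n IH]; first exact: tower_height_gt0.
rewrite /= path_edgeP; apply: leq_trans (leq_height_range _).
by rewrite addnC ltn_add2l.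
Qed.

(** The edges [e] entering a vertex cut the floors of its tower into disjoint blocks, starting at
    [height_below e] and of length [tower_height (esource e)]. So the floor determines the last
    edge, and induction recovers the earlier ones. *)
Lemma tower_pos_inj n (x y : path_space B) : esource (x n) = esource (y n) ->
  tower_pos n x = tower_pos n y -> forall i, i < n -> x i = y i.
Proof.
elim: n => [//|n IH] /=; rewrite !path_edgeP => sxy pxy.
have xyn : x n = y n.
  apply: contrapT => /(edge_lt_total sxy)/orP[] /leq_height_below.
    by have := tower_pos_lt n x; lia.
  by have := tower_pos_lt n y; lia.
move=> i; rewrite ltnS leq_eqVlt => /predU1P[->//|].
by apply: IH; [rewrite xyn | move: pxy; rewrite xyn => /addIn].
Qed.

Lemma tower_pos_maximal n (x : path_space B) :
  (forall i, i < n -> maximal_edge ord (x i)) ->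
  (tower_pos n x).+1 = tower_height (esource (x n)).
Proof.
elim: n => [//|n IH mx]; rewrite path_edgeP height_maximal; last exact: mx.
have {}IH := IH (fun i ilt => mx i (ltnW ilt)).
by rewrite -IH /= addnS addnC.
Qed.

Lemma tower_pos_minimal n (x : path_space B) :
  (forall i, i < n -> minimal_edge ord (x i)) ->
  tower_pos n x = 0.
Proof.
elim: n => [//|n IH mx] /=; rewrite height_below_minimal; last exact: mx.
by rewrite IH// => i ilt; apply: mx; exact: ltnW.
Qed.

(** Let [k] be the index of the edge replaced by its successor. If [k < n], the step climbs one
    floor inside the tower. Otherwise it goes from a top floor to a bottom floor, and edge [n]
    passes to its successor if [k = n], from maximal to minimal if [k > n]. *)
Lemma vershik_step_tower n x y : vershik_step ord x y ->
  (y n = x n /\ tower_pos n y = (tower_pos n x).+1) \/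
  [/\ (tower_pos n x).+1 = tower_height (esource (x n)), tower_pos n y = 0 &
      successor_edge ord (x n) (y n) \/
      maximal_edge ord (x n) /\ minimal_edge ord (y n)].
Proof.
move=> [k [mx nmx sxy my tl]]; have [kn|nk] := ltnP k n.
  left; split; first exact: tl.
  elim: n kn => [//|n IH]; rewrite ltnS leq_eqVlt => /predU1P[<-|kn] /=.
    rewrite (height_below_successor sxy) (tower_pos_minimal my).
    by rewrite add0n -(tower_pos_maximal mx) addnS addnC.
  by rewrite IH// tl.
right; split.
- by apply: tower_pos_maximal => i /leq_trans => /(_ _ nk); exact: mx.
- by apply: tower_pos_minimal => i /leq_trans => /(_ _ nk); exact: my.
move: nk; rewrite leq_eqVlt => /predU1P[->|nk]; [by left|right].
by split; [exact: mx | exact: my].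
Qed.

Lemma orbit_tower (z : nat -> path_space B) n j :
  (forall i, vershik_step ord (z i) (z i.+1)) ->
  tower_pos n (z 0) + j < tower_height (esource (z 0 n)) ->
  z j n = z 0 n /\ tower_pos n (z j) = tower_pos n (z 0) + j.
Proof.
move=> zS; elim: j => [|j IH] lt; first by rewrite addn0.
have [|zj pj] := IH; first by lia.
have [[-> ->]|[top _ _]] := vershik_step_tower n (zS j).
  by rewrite zj pj addnS.
by move: top; rewrite pj zj; lia.
Qed.

Lemma orbit_tower_rev (z : nat -> path_space B) n m j :
  (forall i, vershik_step ord (z i) (z i.+1)) ->
  j <= m -> j <= tower_pos n (z m) ->
  z (m - j) n = z m n /\ tower_pos n (z (m - j)) = tower_pos n (z m) - j.
Proof.
move=> zS; elim: j => [|j IH] jm jp; first by rewrite !subn0.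
have [||zj pj] := IH; [by lia..|].
have := zS (m - j.+1); rewrite subnSK// => /(vershik_step_tower n).
move=> [[<- pz]|[_ p0 _]]; last by lia.
by split=> //; lia.
Qed.

Definition has_later_parallel n (e : edge B n) :=
  exists2 g, edge_lt e g & esource g = esource e.

(** The successor [f] lies between the parallel edges [e] and [g]. *)
Lemma successor_parallel n (e f g : edge B n) : consecutive ord ->
  successor_edge ord e f -> edge_lt e g -> esource g = esource e ->
  esource f = esource e.
Proof.
move=> cons ef eg sg; have [fe _ le H] := ef; have [reg leg neg] := edge_ltP _ _ eg.
apply: (cons n e f g) => //; first by rewrite fe.
by apply: H => // /esym.
Qed.

Lemma predecessor_parallel n (e f g : edge B n) : consecutive ord ->
  successor_edge ord e f -> edge_lt g f -> esource g = esource f ->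
  esource e = esource f.
Proof.
move=> cons ef gf sg; have [fe _ le _] := ef; have [rgf lgf _] := edge_ltP _ _ gf.
rewrite -sg; apply: (cons n g e f) => //; first by rewrite rgf.
move: gf; rewrite (successor_ltE _ ef) => /predU1P[->|/edge_ltP[]//].
exact: edge_le_refl.
Qed.

(** From floor [p], [h - p] steps lead past the top to a bottom floor, and edge [n] becomes its
    successor. By consecutiveness the successor has the same source, so [p] further steps climb to
    floor [p] over the same vertex, and the floor determines the first [n] edges. *)
Lemma return_forward (z : nat -> path_space B) n : consecutive ord ->
  (forall j, vershik_step ord (z j) (z j.+1)) ->
  has_later_parallel (z 0 n) ->
  forall i, i < n -> z (tower_height (esource (z 0 n))) i = z 0 i.
Proof.
move=> cons zS [g zg sg].
set h := tower_height _; set p := tower_pos n (z 0).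
have ph : p < h by exact: tower_pos_lt.
(* Floors are numbered from 0, so the top floor [h - 1] is reached after [h - p.+1] steps. *)
have [|zt pt] := @orbit_tower z n (h - p.+1) zS; first by rewrite -/p -/h; lia.
have := zS (h - p.+1); rewrite subnSK// => st.
have [[z' p']|[_ p0 sz]] := vershik_step_tower n st.
  have := tower_pos_lt n (z (h - p)).
  by rewrite z' p' pt zt -/h -/p; lia.
(* The later parallel edge rules out that edge [n] is maximal. *)
have {}sz : successor_edge ord (z 0 n) (z (h - p) n).
  by rewrite -zt; case: sz => // -[]; rewrite zt => /(edge_lt_maximal zg).
have sf := successor_parallel cons sz zg sg.
have [||zp pp] := @orbit_tower (fun j => z (h - p + j)) n p.
- by move=> j; rewrite addnS; exact: zS.
- by rewrite addn0 p0 sf.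
move: zp pp; rewrite subnK ?(ltnW ph)// addn0 p0 => zp pp i.
by apply: tower_pos_inj; rewrite ?zp// pp.
Qed.

(** The forward argument reversed in time: from time [h], go down [q] floors to the bottom, step
    back to the top of the tower over the same vertex, then go down to floor [q] at time 0. *)
Lemma return_backward (z : nat -> path_space B) n h : consecutive ord ->
  (forall j, vershik_step ord (z j) (z j.+1)) ->
  h = tower_height (esource (z h n)) ->
  (exists2 g, edge_lt g (z h n) & esource g = esource (z h n)) ->
  [/\ esource (z 0 n) = esource (z h n), has_later_parallel (z 0 n) &
      forall i, i < n -> z 0 i = z h i].
Proof.
move=> cons zS hE [g gz sg]; set q := tower_pos n (z h).
have qh : q < h by rewrite [ltnRHS]hE; exact: tower_pos_lt.
have [||zt pt] := @orbit_tower_rev z n h q zS; [exact: ltnW|by []|].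
have := zS (h - q.+1); rewrite subnSK// => st.
have [[_ p']|[top _ sz]] := vershik_step_tower n st.
  by move: pt; rewrite p' -/q; lia.
have {}sz : successor_edge ord (z (h - q.+1) n) (z h n).
  by rewrite -zt; case: sz => // -[] _; rewrite zt => /(edge_lt_minimal gz).
have se := predecessor_parallel cons sz gz sg.
have top' : (tower_pos n (z (h - q.+1))).+1 = h by rewrite top se -hE.
have [||z0 p0] := @orbit_tower_rev z n (h - q.+1) (h - q.+1) zS.
- by [].
- by lia.
rewrite subnn in z0 p0; split.
- by rewrite z0.
- by exists (z h n); rewrite z0//; exact: successor_lt.
by apply: tower_pos_inj; rewrite ?z0// p0 -/q; lia.
Qed.

End towers.

(** * Topology of the path space and countability of sets of paths *)

Section path_space_facts.
Variable B : bratteli.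
Implicit Types (x y : path_space B) (D : set (path_space B)).

Lemma path_ext x y : (forall n, x n = y n) -> x = y.
Proof.
case: x y => [x xP] [y yP] /= xy.
have {}xy : x = y by exact: functional_extensionality_dep.
by rewrite xy in xP *; congr Path; exact: Prop_irrelevance.
Qed.

Lemma cylinder_open n x : open (cylinder (n, x)).
Proof. by exists [set (n, x)] => //; rewrite bigcup_set1. Qed.

Lemma open_cylinder D x : open D -> D x -> exists n, cylinder (n, x) `<=` D.
Proof.
move=> [E _ <-] [[n y] Ey /= yx]; exists n => z zx; exists (n, y) => //.
by move=> i /= ilt; rewrite zx// yx.
Qed.

Definition depends_on n D :=
  forall x y, (forall i, i < n -> x i = y i) -> D x -> D y.

Lemma depends_on_open n D : depends_on n D -> open D.
Proof.
move=> nD; rewrite (_ : D = \bigcup_(x in D) cylinder (n, x)).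
  by apply: bigcup_open => x _; exact: cylinder_open.
apply/seteqP; split => [x Dx|y [x Dx xy]]; first by exists x.
by apply: nD Dx => i ilt; rewrite xy.
Qed.

Lemma set1_closed x : closed [set x].
Proof.
rewrite -[X in closed X]setCK; apply: open_closedC.
rewrite (_ : ~` [set x] =
    \bigcup_(p in [set p : nat * path_space B | ~ cylinder p x]) cylinder p).
  by apply: bigcup_open => -[n y] _; exact: cylinder_open.
apply/seteqP; split => [y /= yx|y [p px py] /= yx]; last first.
  by apply: px; rewrite -yx.
have [n xn] : exists n, x n <> y n.
  apply: contrapT => /forallNP H; apply: yx; apply: path_ext => n.
  by apply: esym; exact: contrapT (H n).
by exists (n.+1, y) => //= /(_ n (ltnSn n)).
Qed.

(** As a dependent finite function the initial segment lives in a finite type, which gives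
    countability. *)
Definition initial_path n x : {dffun forall i : 'I_n, edge B i} :=
  [ffun i : 'I_n => x i].

Lemma initial_pathP n x y :
  initial_path n x = initial_path n y <-> forall i, i < n -> x i = y i.
Proof.
split=> [/ffunP xy i ilt|xy]; last by apply/ffunP => i; rewrite !ffunE xy.
by have := xy (Ordinal ilt); rewrite !ffunE.
Qed.

Lemma cofinal_countable y : countable [set x | cofinal x y].
Proof.
rewrite (_ : [set x | cofinal x y] = \bigcup_N [set x | forall n, N <= n -> x n = y n]).
  apply: bigcup_countable => // N _; apply/countable_injP.
  exists (pickle \o initial_path N) => x z; rewrite !inE /= => xy zy.
  move=> /(pcan_inj pickleK)/initial_pathP xz; apply: path_ext => n.
  by have [/xz//|nN] := ltnP n N; rewrite xy// zy.
by apply/seteqP; split => [x [N xy]|x [N _ xy]]; exists N.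
Qed.

Section backward_unique.
(** [P] stands for maximality or minimality of an edge. *)
Variable P : forall n, edge B n -> Prop.
Hypothesis P_unique : forall n (e f : edge B n),
  P e -> P f -> erange e = erange f -> e = f.

Lemma agree_below n x y : (forall i, i < n -> P (x i)) ->
  (forall i, i < n -> P (y i)) -> esource (x n) = esource (y n) ->
  forall i, i < n -> x i = y i.
Proof.
elim: n => [//|n IH] px py; rewrite !path_edgeP => rxy.
have xyn : x n = y n by apply: P_unique rxy; [exact: px|exact: py].
move=> i; rewrite ltnS leq_eqVlt => /predU1P[->//|].
apply: IH; rewrite ?xyn// => j jn; [apply: px | apply: py]; exact: ltnW.
Qed.

(** Two such paths through a common vertex agree below it, so distinct ones pass through distinct
    vertices at all high levels, and these number at most [d]. *)
Lemma backward_unique_finite :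
  finite_rank B -> finite_set [set x : path_space B | forall n, P (x n)].
Proof.
move=> [d Bd]; apply: contrapT => /(infinite_set_fset d.+1)[S0 SP Sd].
have {S0 SP Sd} [S [Su SP Sd]] : exists S : seq (path_space B),
    [/\ uniq S, forall x, x \in S -> forall n, P (x n) & d < size S].
  exists (finmap.enum_fset S0).
  by split; [exact: finmap.fset_uniq | exact: SP | exact: Sd].
have /choice[f fP] : forall p : path_space B * path_space B,
    exists n, p.1 <> p.2 -> p.1 n <> p.2 n.
  move=> [x y] /=; have [->|xy] := pselect (x = y); first by exists 0.
  apply: contrapT => /forallNP H; apply: xy; apply: path_ext => n.
  by apply: contrapT => xyn; exact: (H n).
(* At this level every two distinct paths of [S] have already differed at some edge below it. *)
pose n := \max_(p <- [seq (x, y) | x <- S, y <- S]) (f p).+1.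
suff Sn : size S <= #|vertex B n|.
  by have := leq_trans Sd (leq_trans Sn (Bd n)); rewrite ltnn.
rewrite -(size_map (fun x : path_space B => esource (x n))) cardE.
apply: uniq_leq_size; last by move=> v _; rewrite mem_enum.
rewrite map_inj_in_uniq// => x y xS yS xyn; apply: contrapT => xy.
apply: (fP (x, y) xy) => /=; apply: (agree_below (n := n)) => //.
- by move=> i _; exact: SP.
- by move=> i _; exact: SP.
have : (x, y) \in [seq (x, y) | x <- S, y <- S].
  by apply/allpairsP; exists (x, y).
by move=> xyS; exact: (leq_bigmax_seq (F := fun p => (f p).+1) _ xyS).
Qed.

End backward_unique.

End path_space_facts.

(** * Regular paths, local constancy and iteration of the Vershik map *)

Section vershik.
Variables (B : bratteli) (ord : edge_order B).

Lemma maximal_edge_unique n (e f : edge B n) : maximal_edge ord e ->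
  maximal_edge ord f -> erange e = erange f -> e = f.
Proof. by move=> me mf ef; apply: (edge_le_anti ef); [exact: mf|exact: me]. Qed.

Lemma minimal_edge_unique n (e f : edge B n) : minimal_edge ord e ->
  minimal_edge ord f -> erange e = erange f -> e = f.
Proof. by move=> me mf ef; apply: (edge_le_anti ef); [exact: me|exact: mf]. Qed.

Lemma successor_edge_unique n (e f g : edge B n) :
  successor_edge ord e f -> successor_edge ord e g -> f = g.
Proof.
move=> [fe nfe ef Hf] [ge nge eg Hg]; apply: (@edge_le_anti _ ord).
- by rewrite fe.
- exact: Hf.
- exact: Hg.
Qed.

Lemma irregular_countable : finite_rank B -> countable (~` regular_paths ord).
Proof.
move=> fB; apply: (@sub_countable _ _ _
  (\bigcup_(y in maximal_path ord) [set x | cofinal x y] `|`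
   \bigcup_(y in minimal_path ord) [set x | cofinal x y])).
  apply: subset_card_le => x /not_andP[] /contrapT[y [my xy]].
    by left; exists y.
  by right; exists y.
rewrite -bigcup2E; apply: bigcup_countable => // i _.
case: i => [|[|i]] /=; last exact: countable0.
  apply: bigcup_countable => [|y _]; last exact: cofinal_countable.
  apply: finite_set_countable.
  exact: (backward_unique_finite (@maximal_edge_unique)).
apply: bigcup_countable => [|y _]; last exact: cofinal_countable.
apply: finite_set_countable.
exact: (backward_unique_finite (@minimal_edge_unique)).
Qed.

(** This is continuity: a path that agrees with [x] up to its first non-maximal edge [k] changes at
    the same edge, to the same successor, and below it both images are the minimal path to the same
    vertex. *)
Lemma vershik_step_local x x' : vershik_step ord x x' -> exists k,
  forall N y y', vershik_step ord y y' ->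
    (forall i, i < maxn N k.+1 -> y i = x i) -> forall i, i < N -> y' i = x' i.
Proof.
move=> [k [mx nmx sx mx' tlx]]; exists k => N y y' [l [my nmy sy my' tly]] yx.
have yxk i : i <= k -> y i = x i.
  by move=> ik; apply: yx; rewrite leq_max ltnS ik orbT.
have lk : l = k.
  have [lk|kl|//] := ltngtP l k; exfalso.
    by apply: nmy; rewrite yxk 1?ltnW//; exact: mx.
  by apply: nmx; rewrite -(yxk k)//; exact: my.
rewrite {l}lk in my nmy sy my' tly *.
have yk : y' k = x' k.
  by apply: successor_edge_unique sx; rewrite -(yxk k).
move=> i iN; have [ik|ki|->//] := ltngtP i k.
  apply: (agree_below (@minimal_edge_unique) (n := k)) => //.
  by rewrite yk.
by rewrite tly// tlx// yx// leq_max iN.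
Qed.

Lemma vershik_step_cofinal x y : vershik_step ord x y -> cofinal y x.
Proof. by move=> [k [_ _ _ _ yx]]; exists k.+1. Qed.

(** Allows iteration, as [T] is prescribed on regular paths only. *)
Lemma vershik_step_regular x y : vershik_step ord x y ->
  regular_paths ord x -> regular_paths ord y.
Proof.
move=> /vershik_step_cofinal[N yx] [nmax nmin].
split=> -[z [mz [M yz]]]; [apply: nmax|apply: nmin]; exists z; split=> //;
  exists (maxn N M) => n; rewrite geq_max => /andP[Nn Mn]; by rewrite -yx// yz.
Qed.

Lemma iter_vershik (T : path_space B -> path_space B) x :
  vershik_map ord T -> regular_paths ord x ->
  forall j, vershik_step ord (iter j T x) (iter j.+1 T x).
Proof.
move=> vT xr j; apply: (vT); elim: j => [//|j IH].
exact: vershik_step_regular (vT _ IH) IH.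
Qed.

End vershik.

Lemma negligible_countable_bigcup d (X : sigmaRingType d) (R : realFieldType)
    (mu : {measure set X -> \bar R}%R) (I : Type) (D : set I) (F : I -> set X) :
  countable D -> (forall i, D i -> mu.-negligible (F i)) ->
  mu.-negligible (\bigcup_(i in D) F i).
Proof.
move=> /countable_injP[f finj] F0.
(* By injectivity of [f] on [D], at most one index contributes to [G n]. *)
pose G n := \bigcup_(i in D `&` [set i | f i = n]) F i.
apply: (@negligibleS _ _ _ _ (\bigcup_n G n)).
  by move=> x [i Di Fx]; exists (f i) => //; exists i.
apply: negligible_bigcup => n.
have [[i [Di fi]]|nD] := pselect (exists i, D i /\ f i = n).
  apply: negligibleS (F0 i Di) => x [j [Dj fj] Fx].
  by rewrite (finj i j) ?inE// fi fj.
rewrite /G bigcup0; first exact: negligible_set0.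
by move=> i [Di fi]; case: nD; exists i.
Qed.

(** * Borel sets of paths *)

Section borel.
Variable B : bratteli.

Lemma open_borel (D : set (borel_path_space B)) :
  open (D : set (path_space B)) -> measurable D.
Proof. by move=> oD; exact: sub_sigma_algebra. Qed.

Lemma depends_on_borel n (D : set (borel_path_space B)) :
  depends_on n D -> measurable D.
Proof. by move=> nD; apply: open_borel; exact: depends_on_open nD. Qed.

Lemma set1_borel (x : borel_path_space B) : measurable [set x].
Proof.
rewrite -[X in measurable X]setCK; apply: measurableC; apply: open_borel.
by apply: closed_openC; exact: set1_closed.
Qed.

Lemma countable_borel (D : set (borel_path_space B)) :
  countable D -> measurable D.
Proof. by apply: countable_measurable; exact: set1_borel. Qed.

End borel.

Lemma parallel_edge_before (B : bratteli) (ord : edge_order B) n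
    (e : edge B n) : multiple_edges B -> 0 < n -> ~ has_later_parallel ord e ->
  exists2 g, edge_lt ord g e & esource g = esource e.
Proof.
move=> mult n0 nl.
have /card_gt1P[f [g []]] := mult n _ _ n0 (ex_intro _ e (conj erefl erefl)).
rewrite !inE => /andP[/eqP fs /eqP fr] /andP[/eqP gs /eqP gr] fg.
have [k [ks kr /eqP ke]] : exists k : edge B n,
    [/\ esource k = esource e, erange k = erange e & k != e].
  have [fe|fe] := eqVneq f e; last by exists f.
  by exists g; rewrite gs gr -fe eq_sym.
have /orP[lt|lt] := edge_lt_total ord kr ke; first by exists k.
by case: nl; exists k.
Qed.

(** * Measurability of the map and measure estimates *)

Section vershik_measure.
Variables (R : realType) (B : bratteli) (ord : edge_order B).
Variable T : borel_path_space B -> borel_path_space B.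
Variable mu : probability (borel_path_space B) R.
Hypothesis fB : finite_rank B.
Hypothesis vT : vershik_map ord T.
Hypothesis na : non_atomic mu.
Hypothesis inv : invariant_measure mu T.

Notation Reg := (regular_paths ord : set (borel_path_space B)).

Lemma irregular_borel (D : set (borel_path_space B)) :
  D `<=` ~` Reg -> measurable D.
Proof.
move=> DReg; apply: countable_borel.
by apply: (sub_countable (subset_card_le DReg)); exact: irregular_countable.
Qed.

Lemma regular_borel : measurable Reg.
Proof.
rewrite -[X in measurable X]setCK; apply: measurableC.
exact: irregular_borel.
Qed.

(* T is continuous on the regular paths, whose complement is countable. *)
Lemma vershik_measurable : measurable_fun setT T.
Proof.
apply: (@measurability _ _ _ (borel_path_space B) setT T
  (@open (path_space B)) erefl) => _ [V oV <-].
pose U := \bigcup_(p in [set p | cylinder p `&` Reg `<=` T @^-1` V]) cylinder p.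
rewrite setTI (_ : T @^-1` V = (T @^-1` V `\` Reg) `|` (U `&` Reg)).
  apply: measurableU; first by apply: irregular_borel => x [].
  apply: measurableI; last exact: regular_borel.
  apply: open_borel; apply: (@bigcup_open (path_space B)) => -[n x] _.
  exact: cylinder_open.
apply/seteqP; split=> [x Vx|x]; last first.
  by case=> [[]//|[[p /= pV px] xR]]; exact: pV.
have [xR|] := pselect (Reg x); [right; split=> //|by left].
have [N NV] := open_cylinder oV Vx.
have [k kP] := vershik_step_local (vT xR).
exists (maxn N k.+1, x) => //= y [/= yx yR].
by apply: NV; exact: kP (vT yR) yx.
Qed.

Lemma measure_set1 x : mu [set x] = 0%E.
Proof.
apply: contrapT => /eqP mux; apply: na; exists [set x]; split.
- exact: set1_borel.
- by rewrite lt0e mux measure_ge0.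
- by move=> C _ /subset_set1[->|->]; [left; rewrite measure0|right].
Qed.

Lemma negligible_irregular : mu.-negligible (~` Reg).
Proof.
rewrite (_ : ~` Reg = \bigcup_(x in ~` Reg) [set x]).
  apply: negligible_countable_bigcup; first exact: irregular_countable.
  by move=> x _; apply/negligibleP; [exact: set1_borel|exact: measure_set1].
by apply/seteqP; split => [x xR|x [y yR ->]]; first exists x.
Qed.

(** Inclusions derived from the dynamics hold only on regular paths, whose complement is null. *)
Lemma le_measure_regular (C D : set (borel_path_space B)) :
  measurable C -> measurable D -> C `&` Reg `<=` D -> (mu C <= mu D)%E.
Proof.
move=> mC mD CD; rewrite -(measureU0 mD (irregular_borel (@subset_refl _ _))).
  apply: le_measure; rewrite ?inE//; first exact: measurableU (irregular_borel _).
  by move=> x Cx; have [xR|xR] := pselect (Reg x); [left; exact: CD|right].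
by apply: measure_negligible negligible_irregular; exact: irregular_borel.
Qed.

Lemma iter_vershik_measurable n : measurable_fun setT (iter n T).
Proof.
elim: n => [|n IH]; first exact: measurable_id.
exact: measurableT_comp vershik_measurable IH.
Qed.

Lemma iter_preimage_borel n (C : set (borel_path_space B)) :
  measurable C -> measurable (iter n T @^-1` C).
Proof.
move=> mC; rewrite -[X in measurable X]setTI.
exact: iter_vershik_measurable.
Qed.

Lemma measure_iter_preimage n (C : set (borel_path_space B)) :
  measurable C -> mu (iter n T @^-1` C) = mu C.
Proof.
move=> mC; elim: n => [//|n IH].
rewrite -IH -[RHS]inv; last exact: iter_preimage_borel.
by congr (mu _); apply/seteqP; split=> x /=; rewrite -iterSr.
Qed.

Lemma return_measure (n : nat) (v : vertex B n)
    (A : set (borel_path_space B)) : consecutive ord -> multiple_edges B ->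
  0 < n -> depends_on n A ->
  (mu (A `&` [set x | esource (x n) = v]) <=
   mu (A `&` iter (tower_height v) T @^-1` A) *+ 2)%E.
Proof.
move=> cons mult n0 nA; set h := tower_height v.
pose Av := A `&` [set x | esource (x n) = v].
pose later := [set x : borel_path_space B | has_later_parallel ord (x n)].
(* The vertex at level [n] and the next edge are both read off the edge of index [n], hence
   [n.+1]. *)
have nAv : depends_on n.+1 Av.
  move=> x y xy [Ax xv]; split; last by rewrite /= -xy.
  by apply: nA Ax => i ilt; apply: xy; exact: ltnW.
have mA : measurable A by exact: depends_on_borel nA.
have mN : measurable (Av `&` later).
  apply: (@depends_on_borel _ n.+1) => x y xy [Ax xl].
  by split; [exact: nAv Ax | rewrite /later /= -xy].
have mL : measurable (Av `\` later).
  apply: (@depends_on_borel _ n.+1) => x y xy [Ax xl].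
  by split; [exact: nAv Ax | rewrite /later /= -xy].
have NA : (mu (Av `&` later) <= mu (A `&` iter h T @^-1` A))%E.
  apply: le_measure_regular => //.
    by apply: measurableI => //; exact: iter_preimage_borel.
  move=> x [[[Ax /= xv] xl] xR]; split=> //=; apply: nA Ax => i ilt.
  by have := return_forward cons (iter_vershik vT xR) xl ilt; rewrite /= xv => ->.
have LN : (mu (Av `\` later) <= mu (Av `&` later))%E.
  rewrite -(measure_iter_preimage h mL); apply: le_measure_regular => //.
    exact: iter_preimage_borel.
  move=> x [[[Ay /= yv] yl] xR].
  (* The time-[h] image has no later parallel edge, so it has an earlier one, and the starting point
     lies in [Av] with a later parallel edge. *)
  have [||xv xl xy] := @return_backward _ _ (fun j => iter j T x) n h cons
    (iter_vershik vT xR).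
  - by rewrite yv.
  - exact: parallel_edge_before.
  by split=> //; split; [apply: nA Ay => i /xy-> | rewrite /= -yv -xv].
rewrite -/Av -(setUIDK Av later).
apply: le_trans (measureU2 mu mN mL) _; rewrite mule2n.
by apply: leeD => //; exact: le_trans NA.
Qed.

(** Otherwise the space would be covered by null cylinders, of which there are countably many. *)
Lemma positive_cylinders : exists x, forall n, (0 < mu (cylinder (n, x)))%E.
Proof.
apply: contrapT => nx.
pose C n (c : {dffun forall i : 'I_n, edge B i}) : set (borel_path_space B) :=
  [set x | initial_path n x = c].
suff /(negligibleP _ measurableT) mu0 :
    mu.-negligible [set: borel_path_space B].
  have : (mu [set: borel_path_space B] = 1)%E := probability_setT mu.
  by apply/eqP; rewrite mu0 eq_sym onee_eq0.
apply: (@negligibleS _ _ _ _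
    (\bigcup_n \bigcup_(c in [set c | mu.-negligible (C n c)]) C n c)); last first.
  apply: negligible_bigcup => n; apply: negligible_countable_bigcup => //.
  exact: countableP.
move=> x _; have [n xn] : exists n, ~ (0 < mu (cylinder (n, x)))%E.
  by apply: contrapT => /forallNP xP; apply: nx; exists x => n; exact: contrapT (xP n).
exists n => //; exists (initial_path n x) => //=.
have -> : C n (initial_path n x) = cylinder (n, x).
  by apply/seteqP; split => y /initial_pathP.
apply/negligibleP; first by apply: open_borel; exact: cylinder_open.
by apply/eqP; rewrite -measure_le0 leNgt; exact/negP.
Qed.

(** The cylinders around a path all of whose cylinders have positive measure shrink to a point,
    which is null. *)
Lemma small_cylinder (e : R) : (0 < e)%R -> exists n x,
  (0 < mu (cylinder (n, x)) < e%:E)%E.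
Proof.
move=> e0; have [x x0] := positive_cylinders.
have mC n : measurable (cylinder (n, x) : set (borel_path_space B)).
  by apply: open_borel; exact: cylinder_open.
have capC : \bigcap_n cylinder (n, x) = [set x].
  apply/seteqP; split=> [y xy|_ -> n _ //].
  by apply: path_ext => n; apply: (xy n.+1) => //=.
have : (mu \o (fun n => cylinder (n, x))) n @[n --> \oo] --> mu [set x].
  rewrite -capC; apply: nonincreasing_cvg_mu => //.
  - by rewrite -ge0_fin_numE// fin_num_measure.
  - by rewrite capC; exact: set1_borel.
  - move=> n m nm; apply/subsetPset => y /= ym i ilt.
    by apply: ym; exact: leq_trans nm.
rewrite measure_set1 => mu0.
have [n _ /(_ n (leqnn n)) xe] :
    \forall n \near \oo, (mu (cylinder (n, x)) < e%:E)%E.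
  apply: (mu0 [set y | (y < e%:E)%E]); apply: open_nbhs_nbhs.
  by split; [exact: open_ereal_lt_ereal | rewrite /= lte_fin].
by exists n, x; rewrite x0.
Qed.

Lemma measure_fin_cover_le (I : finType) (F : I -> set (borel_path_space B))
    (C : set (borel_path_space B)) (c : R) :
  (forall i, measurable (F i)) -> measurable C -> C `<=` \bigcup_i F i ->
  (forall i, mu (F i) <= c%:E)%E -> (mu C <= (c *+ #|I|)%:E)%E.
Proof.
move=> mF mC CF Fc.
have mus s : (mu (\big[setU/set0]_(i <- s) F i) <= (c *+ size s)%:E)%E.
  elim: s => [|i s IH]; first by rewrite big_nil measure0.
  rewrite big_cons /= mulrS EFinD; apply: le_trans (measureU2 _ _ _) _ => //.
    exact: bigsetU_measurable.
  by apply: leeD => //; exact: Fc.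
rewrite cardE; apply: le_trans (mus _); apply: le_measure; rewrite ?inE//.
  exact: bigsetU_measurable.
by move=> x /CF[i _ Fx]; rewrite -bigcup_seq; exists i => //=; rewrite mem_enum.
Qed.

End vershik_measure.

(** * The contradiction with mixing *)

Theorem theorem7p3 (R : realType) (B : bratteli) (ord : edge_order B)
  (T : borel_path_space B -> borel_path_space B)
  (mu : probability (borel_path_space B) R) :
  finite_rank B -> standing_assumptions B -> consecutive ord ->
  multiple_edges B -> vershik_map ord T ->
  non_atomic mu -> invariant_measure mu T ->
  ~ strongly_mixing mu T.
Proof.
move=> fB _ cons mult vT na inv mix; have [d Bd] := fB.
(* Using [d.+1] keeps [e] well defined and makes [2 * d * e] strictly less than 1. *)
pose e : R := ((d.+1 * 2)%:R^-1)%R.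
have e0 : (0 < e)%R by rewrite invr_gt0 ltr0n.
have [m [x /andP[A0 Ae]]] := small_cylinder na e0.
set A : set (borel_path_space B) := cylinder (m, x) in A0 Ae.
have mA : measurable A by apply: open_borel; exact: cylinder_open.
pose a := fine (mu A).
have muA : mu A = a%:E by rewrite fineK// fin_num_measure.
rewrite muA !lte_fin in A0 Ae.
(* Mixing of [A] with itself gives the limit [a * a], which is below [a * e]. *)
have [N _ small] : \forall n \near \oo,
    (mu (A `&` iter n T @^-1` A) < (a * e)%:E)%E.
  apply: (mix A A mA mA [set y | (y < (a * e)%:E)%E]).
  apply: open_nbhs_nbhs; split.
    exact: open_ereal_lt_ereal.
  by rewrite /= muA -EFinM lte_fin ltr_pM2l.
(* [N] makes all tower heights large enough for [small], [m] makes [A] depend on the first [n]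
   edges, and 1 gives access to parallel edges. *)
pose n := maxn (maxn N m) 1.
have nA : depends_on n A.
  move=> y z yz Ay i /= im; rewrite -yz ?Ay//.
  by rewrite /n !leq_max im orbT.
have : (mu A <= (a * e *+ 2 *+ #|vertex B n|)%:E)%E.
  apply: (@measure_fin_cover_le _ _ mu _
      (fun v => A `&` [set y | esource (y n) = v])) => // [v||v].
  - apply: (@depends_on_borel _ n.+1) => y z yz [Ay yv].
    split; last by rewrite /= -yz.
    by apply: nA Ay => i ilt; apply: yz; exact: ltnW.
  - by move=> y Ay; exists (esource (y n)).
  apply: le_trans (return_measure fB vT na inv v cons mult _ nA) _.
    by rewrite /n leq_max orbT.
  rewrite mule2n [X in (_ <= X%:E)%E]mulr2n EFinD.
  have lt : N <= tower_height v.
    have Nn : N <= n by rewrite /n !leq_max leqnn.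
    exact: leq_trans Nn (tower_height_ge ord v mult).
  by apply: leeD; apply: ltW; exact: small lt.
(* Dividing by [a], what remains is that twice the number of vertices of level [n] is less than
   [d.+1 * 2]. *)
rewrite muA lee_fin leNgt => /negP; apply.
rewrite -mulrnA -mulr_natr -mulrA gtr_pMr// mulrC ltr_pdivrMr ?ltr0n//.
by rewrite mul1r ltr_nat; have := Bd n; lia.
Qed.
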